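(* Let $(A,\cdot)$ be a Jacobi-Jordan-admissible algebra. Then $(A,\cdot)$ is an $\mathcal{A}\mathrm{BD}$-algebra if and only if $L_x-R_x$ is an antiderivation of $(A,\circ)$ for every $x\in A$, i.e. $$[x,y\circ z]=-\big([x,y]\circ z+y\circ[x,z]\big)\qquad\text{for all } x,y,z\in A.$$
   Context: All algebras are over $\mathbb{C}$; an algebra $(A,\cdot)$ is a vector space with a bilinear (not necessarily associative) multiplication. Write $x\circ y = x\cdot y+y\cdot x$, $[x,y]=x\cdot y-y\cdot x$, $L_x(t)=x\cdot t$, $R_x(t)=t\cdot x$. A Jacobi-Jordan algebra is a commutative algebra satisfying the Jacobi identity $x(yz)+y(zx)+z(xy)=0$. $(A,\cdot)$ is Jacobi-Jordan-admissible if $(A,\circ)$ is a Jacobi-Jordan algebra. An antiderivation of an algebra $(B,\ast)$ is a linear map $\varphi:B\to B$ with $\varphi(x\ast y)=-\big(\varphi(x)\ast y+x\ast\varphi(y)\big)$ for all $x,y$. An algebra $(A,\cdot)$ is called an $\mathcal{A}\mathrm{BD}$-algebra (algebra of anti-biderivation-type) if for all $x,y,z\in A$: $x\cdot(y\circ z) = -\big((x\cdot y)\circ z+y\circ(x\cdot z)\big)$ and $(y\circ z)\cdot x=-\big((y\cdot x)\circ z+y\circ(z\cdot x)\big)$. *)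

(* Defs.v *)
From HB Require Import structures.
From mathcomp Require Import all_boot all_order all_algebra.

Set Implicit Arguments.
Unset Strict Implicit.
Unset Printing Implicit Defensive.

Import GRing.Theory.
Local Open Scope ring_scope.

(* MathComp has no structure of non-associative algebra: an algebra over K is
   rendered as an lmodType A, of arbitrary dimension, together with a
   multiplication mul : {bilinear A -> A -> A}. *)

Section Operations.
Variables (K : comNzRingType) (A : lmodType K) (mul : {bilinear A -> A -> A}).

Definition circ (x y : A) : A := mul x y + mul y x.

Definition commutator (x y : A) : A := mul x y - mul y x.

Definition lmult (x t : A) : A := mul x t.

Definition rmult (x t : A) : A := mul t x.

Fact circ_is_bilinear : bilinear_for *:%R *:%R circ.
Proof.
by split=> u a x y /=; rewrite /circ linearPl linearPr /= scalerDr addrACA.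
Qed.

HB.instance Definition _ :=
  bilinear_isBilinear.Build K A A A *:%R *:%R circ circ_is_bilinear.

Fact lmult_is_linear x : linear (lmult x).
Proof. by move=> a u v; rewrite /lmult linearPr. Qed.

HB.instance Definition _ x :=
  GRing.isLinear.Build K A A *:%R (lmult x) (lmult_is_linear x).

Fact rmult_is_linear x : linear (rmult x).
Proof. by move=> a u v; rewrite /rmult linearPl. Qed.

HB.instance Definition _ x :=
  GRing.isLinear.Build K A A *:%R (rmult x) (rmult_is_linear x).

End Operations.

Section Predicates.
Variables (K : comNzRingType) (A : lmodType K).
Implicit Types (mul : {bilinear A -> A -> A}) (phi : {linear A -> A}).

Definition jacobi_jordan mul : Prop :=
  commutative mul /\
  forall x y z : A, mul x (mul y z) + mul y (mul z x) + mul z (mul x y) = 0.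

Definition jacobi_jordan_admissible mul : Prop := jacobi_jordan (circ mul).

Definition antiderivation mul phi : Prop :=
  forall x y : A, phi (mul x y) = - (mul (phi x) y + mul x (phi y)).

Definition ABD_algebra mul : Prop :=
  forall x y z : A,
    mul x (circ mul y z) = - (circ mul (mul x y) z + circ mul y (mul x z)) /\
    mul (circ mul y z) x = - (circ mul (mul y x) z + circ mul y (mul z x)).

End Predicates.

(* Main.v *)
(* The Jacobi identity of (A, circ) says that L_x + R_x is an antiderivation
   of (A, circ), and the ABD identities say that L_x and R_x both are.
   Antiderivations form a vector space, so as 2 is invertible L_x and R_x are
   antiderivations if and only if L_x + R_x and L_x - R_x are. *)

Require Import Defs.
From mathcomp Require Import all_boot all_order all_algebra.
From mathcomp Require Import reals complex.

Set Implicit Arguments.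
Unset Strict Implicit.
Unset Printing Implicit Defensive.

Import GRing.Theory.
Local Open Scope ring_scope.
Local Open Scope complex_scope.

Section Antiderivations.
Variables (K : comNzRingType) (A : lmodType K).
Implicit Types (mul : {bilinear A -> A -> A}) (phi psi : {linear A -> A}).

(** Pointwise equality suffices, so a linear combination of maps can be replaced by the map it
    simplifies to, without function extensionality. *)
Lemma eq_antiderivation mul phi psi :
  phi =1 psi -> antiderivation mul phi -> antiderivation mul psi.
Proof. by move=> eq_phi Hphi x y; rewrite -!eq_phi. Qed.

Lemma antiderivationD mul phi psi :
  antiderivation mul phi -> antiderivation mul psi ->
  antiderivation mul (phi \+ psi).
Proof.
move=> Hphi Hpsi x y /=.
by rewrite Hphi Hpsi linearDl linearDr /= -opprD addrACA.
Qed.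

Lemma antiderivationZ mul (a : K) phi :
  antiderivation mul phi -> antiderivation mul (a \*: phi).
Proof.
by move=> Hphi x y /=; rewrite Hphi linearZl_LR linearZr /= scalerN scalerDr.
Qed.

Lemma antiderivationB mul phi psi :
  antiderivation mul phi -> antiderivation mul psi ->
  antiderivation mul (phi \- psi).
Proof.
move=> Hphi /(antiderivationZ (-1)) /(antiderivationD Hphi).
by apply: eq_antiderivation => x /=; rewrite scaleN1r.
Qed.

(** The sum of the two multiplications by [x] unfolds to [circ mul x], so this is the Jacobi
    identity with two of its terms moved across the equality. *)
Lemma jacobi_jordan_admissible_antiderivation mul x :
  jacobi_jordan_admissible mul ->
  antiderivation (circ mul) (lmult mul x \+ rmult mul x).
Proof.
case=> circC jacobi y z; apply/eqP; rewrite -addr_eq0; apply/eqP.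
(* Commutativity turns the cyclic form of the identity into the Leibniz-like form, with [x] acting
   on [y] and on [z] from the left. *)
have := jacobi x y z; rewrite (circC z x) (circC z (circ mul x y)).
by rewrite -addrA [X in _ + X]addrC.
Qed.

End Antiderivations.

(** Half the sum of [phi \+ psi] and [phi \- psi] is [phi], and half their difference is [psi]. *)
Lemma antiderivation_add_sub (K : comUnitRingType) (A : lmodType K)
    (mul : {bilinear A -> A -> A}) (phi psi : {linear A -> A}) :
  2%:R \is a @GRing.unit K ->
  antiderivation mul (phi \+ psi) -> antiderivation mul (phi \- psi) ->
  antiderivation mul phi /\ antiderivation mul psi.
Proof.
move=> u2 HD HB; split.
  apply: eq_antiderivation (antiderivationZ 2%:R^-1 (antiderivationD HD HB)).
  by move=> x /=; rewrite addrACA subrr addr0 -mulr2n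
    -[phi x *+ 2]scaler_nat scalerA mulVr ?scale1r.
apply: eq_antiderivation (antiderivationZ 2%:R^-1 (antiderivationB HD HB)).
by move=> x /=; rewrite opprB addrC addrA subrK -mulr2n
    -[psi x *+ 2]scaler_nat scalerA mulVr ?scale1r.
Qed.

Lemma ABD_algebraP (K : comNzRingType) (A : lmodType K)
    (mul : {bilinear A -> A -> A}) :
  ABD_algebra mul <->
  forall x, antiderivation (circ mul) (lmult mul x) /\
            antiderivation (circ mul) (rmult mul x).
Proof.
split=> [HA x | HA x y z]; first by split=> y z; case: (HA x y z).
by have [HL HR] := HA x; split; [apply: HL | apply: HR].
Qed.

Theorem proposition29 (R : realType) (A : lmodType R[i])
    (mul : {bilinear A -> A -> A}) :
  jacobi_jordan_admissible mul ->
  (ABD_algebra mul <->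
   forall x : A, antiderivation (circ mul) (lmult mul x \- rmult mul x)) /\
  ((forall x : A, antiderivation (circ mul) (lmult mul x \- rmult mul x)) <->
   forall x y z : A,
     commutator mul x (circ mul y z) =
     - (circ mul (commutator mul x y) z + circ mul y (commutator mul x z))).
Proof.
(* The second equivalence holds by conversion: [lmult mul x \- rmult mul x] applied to [t] unfolds
   to [commutator mul x t]. *)
move=> HJ; split; last by split=> H x y z; apply: H.
apply: iff_trans (ABD_algebraP mul) _; split=> HA x.
  by have [HL HR] := HA x; apply: antiderivationB.
apply: antiderivation_add_sub (HA x).
  (* [R[i]] is a field of characteristic zero, so 2 is invertible. *)
  by rewrite unitfE Num.Theory.pnatr_eq0.
exact: jacobi_jordan_admissible_antiderivation.
Qed.
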